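(* Let $N>1$, $K\in\mathbb{R}$, $q\in(0,1)$, and let $(X,\ell,\tau,\mathfrak{m})$ be a measured globally hyperbolic synthetic spacetime with $\ell_+$ continuous. If $X$ satisfies $\mathsf{TCD}_q(K,N)$, then $X$ satisfies $\mathsf{sTBM}_q(K,N')$ for all $N'>N$. If $X$ satisfies $\mathsf{TCD}_q^e(K,N)$, then $X$ satisfies $\mathsf{sTBM}_q^*(K,N)$.
   Context: **Spaces.** A causal space $(X,\ell)$ is a set $X$ with $\ell:X\times X\to\{-\infty\}\cup[0,\infty]$ such that $\ell(x,x)\ge 0$ and $\ell(x,y)\ge \ell(x,z)+\ell(z,y)$ for all $x,y,z$ (convention $-\infty+a=a+(-\infty)=-\infty$). Put $\ell_+=\max\{\ell,0\}$; $x\le y$ iff $\ell(x,y)\ge0$; $x\ll y$ iff $\ell(x,y)>0$; $X^2_\ll=\{(x,y):x\ll y\}$. For $A,B\subset X$, $J(A,B)=\{z: a\le z\le b \text{ for some } a\in A,\ b\in B\}$. Given a topology $\tau$, a geodesic is a continuous $\gamma:[0,1]\to X$ with $\gamma_s\le\gamma_t$ and $\ell(\gamma_s,\gamma_t)=(t-s)\ell(\gamma_0,\gamma_1)$ for all $0\le s\le t\le1$. $\mathrm{Geo}(X)\subset C([0,1],X)$ is the set of geodesics and $e_t(\gamma)=\gamma_t$. A synthetic spacetime is a triple $(X,\ell,\tau)$ with $\tau$ Polish, $\ell$ upper semicontinuous and never equal to $+\infty$, and such that any $x\le y$ are joined by a geodesic. It is globally hyperbolic if $J(C_1,C_2)$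 is compact for all compact $C_1,C_2$. It is measured if equipped with a Radon measure $\mathfrak{m}$ with $\mathrm{spt}\,\mathfrak{m}=X$. **Optimal transport.** $\mathcal{P}(X)$: Borel probability measures; $\mathcal{P}_c^{ac}(X)$: those with compact support and absolutely continuous w.r.t. $\mathfrak{m}$. $\Pi(\mu,\nu)$: couplings. $\ell_q(\mu,\nu)=\sup_{\pi\in\Pi(\mu,\nu)}\big(\int\ell^q d\pi\big)^{1/q}$, with $(-\infty)^q=(-\infty)^{1/q}=-\infty$ (the integral is $-\infty$ if $\pi(\ell=-\infty)>0$). $\mathrm{Opt}_q(\mu,\nu)$: couplings attaining the supremum; $\mathrm{TOpt}_q(\mu,\nu)$: those concentrated on $X_\ll^2$. A timelike $q$-optimal plan between $\mu,\nu$ is $\eta\in\mathcal{P}(\mathrm{Geo}(X))$ with $(e_0\times e_1)_\#\eta\in\mathrm{TOpt}_q(\mu,\nu)$. A pair $(\mu,\nu)$ is dualizable if $\ell(x,y)\le a(x)+b(y)$ for some lower semicontinuous $a\in L^1(\mu)$, $b\in L^1(\nu)$. A dualizable pair is $q$-timelike if $\mathrm{TOpt}_q(\mu,\nu)\neq\emptyset$. For a Borel set $A$ with $0<\mathfrak{m}(A)<\infty$ let $\mathfrak{m}_A=\mathfrak{m}(A)^{-1}\mathfrak{m}|_A$; a pair of Borel sets $(A,B)$ of positive finite measure is $q$-timelike if $(\mathfrak{m}_A,\mathfrak{m}_B)$ is. **Coefficients.** $\sin_k$ solves $f''+kf=0$, $f(0)=0$, $f'(0)=1$. For $t\in[0,1]$,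 $\theta\ge0$: $\sigma_k^{(t)}(\theta)=\sin_k(t\theta)/\sin_k(\theta)$ if $k\theta^2<\pi^2$ (equal to $t$ at $\theta=0$), and $+\infty$ otherwise; $\tau_{K,N}^{(t)}(\theta)=t^{1/N}\big(\sigma_{K/(N-1)}^{(t)}(\theta)\big)^{1-1/N}$. **Conditions.** $S_N(\mu)=-\int(d\mu/d\mathfrak{m})^{1-1/N}d\mathfrak{m}$, where $d\mu/d\mathfrak{m}$ is the density of the absolutely continuous part of $\mu$. $\mathrm{Ent}(\mu)=\int\rho\log\rho\,d\mathfrak{m}$ if $\mu=\rho\mathfrak{m}$, $+\infty$ otherwise; $U_N(\mu)=\exp(-\mathrm{Ent}(\mu)/N)$. $\mathsf{TCD}_q(K,N)$: every $q$-timelike pair $(\mu_0,\mu_1)=(\rho_0\mathfrak{m},\rho_1\mathfrak{m})\in\mathcal{P}_c^{ac}(X)^2$ admits a timelike $q$-optimal plan $\eta$ such that for all $N'>N$ and all $t\in[0,1]$ $$S_{N'}((e_t)_\#\eta)\le-\int\Big(\tau_{K,N'}^{(1-t)}(\ell(\gamma_0,\gamma_1))\rho_0(\gamma_0)^{-1/N'}+\tau_{K,N'}^{(t)}(\ell(\gamma_0,\gamma_1))\rho_1(\gamma_1)^{-1/N'}\Big)d\eta(\gamma).$$ $\mathsf{TCD}_q^e(K,N)$: every $q$-timelike pair $(\mu_0,\mu_1)\in\mathcal{P}_c^{ac}(X)^2$ admits a timelike $q$-optimal plan $\eta$ such that for all $t\in[0,1]$ $$U_N((e_t)_\#\eta)\ge\sigma_{K/N}^{(1-t)}(\Lambda)U_N(\mu_0)+\sigma_{K/N}^{(t)}(\Lambda)U_N(\mu_1),\qquad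 \Lambda=\Big(\int\ell^2(\gamma_0,\gamma_1)\,d\eta(\gamma)\Big)^{1/2}.$$ $\mathsf{sTBM}_q(K,N)$: for any $q$-timelike pair $(A,B)$ of compact sets there is a timelike $q$-optimal plan $\eta$ between $\mathfrak{m}_A$ and $\mathfrak{m}_B$ such that for all $t\in[0,1]$ $$\mathfrak{m}(\mathrm{spt}(e_t)_\#\eta)^{1/N}\ge\tau_{K,N}^{(1-t)}(\Theta)\mathfrak{m}(A)^{1/N}+\tau_{K,N}^{(t)}(\Theta)\mathfrak{m}(B)^{1/N},$$ where $\Theta=\inf_{A\times B}\ell_+$ if $K\ge0$ and $\Theta=\sup_{A\times B}\ell_+$ if $K<0$. $\mathsf{sTBM}_q^*(K,N)$: the same with $\tau_{K,N}^{(1-t)},\tau_{K,N}^{(t)}$ replaced by $\sigma_{K/N}^{(1-t)},\sigma_{K/N}^{(t)}$. *)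

(* Defs.v *)
From HB Require Import structures.
Set Warnings "-notation-overridden,-ambiguous-paths,-notation-incompatible-prefix".
From mathcomp Require Import all_boot all_order all_algebra.
From mathcomp Require Import all_classical all_reals all_analysis.
From mathcomp Require Import ring lra.

Set Implicit Arguments.
Unset Strict Implicit.
Unset Printing Implicit Defensive.

Import Order.TTheory GRing.Theory Num.Theory.
Import numFieldNormedType.Exports.

Local Open Scope classical_set_scope.
Local Open Scope ring_scope.

HB.instance Definition _ (T U : ptopologicalType) := Pointed.on (T * U)%type.

Notation borel T := (g_sigma_algebraType (@open T)).

Lemma continuous_borel_measurable (T U : ptopologicalType)
    (f : borel T -> borel U) :
  continuous (f : T -> U) -> measurable_fun [set: borel T] f.
Proof.
move=> /continuousP cf.
apply: (@measurability _ _ _ (borel U) _ _ (@open U)) => //.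
by move=> _ [A oA <-]; rewrite setTI; apply: sub_gen_smallest; exact: cf.
Qed.

Section topology.
Context {R : realType}.

Definition polish (T : topologicalType) : Prop :=
  (exists2 D : set T, countable D & dense D) /\
  exists d : T -> T -> R,
  [/\ forall x y, d x y = 0 <-> x = y,
      forall x y, d x y = d y x,
      forall x y z, d x z <= d x y + d y z,
      forall x (A : set T),
        nbhs x A <-> exists2 e : R, 0 < e & [set y | d x y < e] `<=` A
    & forall u : nat -> T,
        (forall e : R, 0 < e -> exists n, forall i j : nat,
           (n <= i)%N -> (n <= j)%N -> d (u i) (u j) < e) ->
        exists x : T, u @ \oo --> x].

Definition upper_semicontinuous (T : topologicalType) (f : T -> \bar R) :=
  forall x a, (f x < a%:E)%E ->
  exists2 V, nbhs x V & forall y, V y -> (f y < a%:E)%E.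

Definition spt (T : topologicalType) (mu : set T -> \bar R) : set T :=
  [set x | forall U, open U -> U x -> (0 < mu U)%E].

Definition radon (T : ptopologicalType) (m : {measure set (borel T) -> \bar R})
  : Prop :=
  (forall x : T, exists U : set T, [/\ open U, U x & (m U < +oo)%E]) /\
  (forall B : set (borel T), measurable B ->
     m B = ereal_sup [set m C | C in [set C : set T | compact C /\ C `<=` B]]).

End topology.

Section causal_space.
Local Open Scope ereal_scope.
Context {R : realType}.

(* In \bar R, -oo + a = a + -oo = -oo for every a, including +oo. *)
Definition causal_space (X : Type) (l : X -> X -> \bar R) : Prop :=
  [/\ forall x y, l x y = -oo \/ 0 <= l x y,
      forall x, 0 <= l x x
    & forall x y z, l x z + l z y <= l x y].

Definition ell_plus (X : Type) (l : X -> X -> \bar R) x y := maxe (l x y) 0.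

Definition causal (X : Type) (l : X -> X -> \bar R) x y : Prop := 0 <= l x y.

Definition chronological (X : Type) (l : X -> X -> \bar R) x y : Prop :=
  0 < l x y.

Definition diamond (X : Type) (l : X -> X -> \bar R) (A B : set X) : set X :=
  [set z | exists a b, [/\ A a, B b, causal l a z & causal l z b]].

Definition I01 : Type := `[0%R, 1%R]%classic : set R.
HB.instance Definition _ := Topological.on I01.

Lemma I01_0_subproof : (0%R : R) \in `[0%R, 1%R]%classic.
Proof. by rewrite inE /= in_itv /= lexx ler01. Qed.
Lemma I01_1_subproof : (1%R : R) \in `[0%R, 1%R]%classic.
Proof. by rewrite inE /= in_itv /= lexx ler01. Qed.
Definition I0 : I01 := SigSub I01_0_subproof.
Definition I1 : I01 := SigSub I01_1_subproof.

Definition geodesic (X : topologicalType) (l : X -> X -> \bar R)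
    (c : I01 -> X) : Prop :=
  continuous c /\
  forall s t : I01, (\val s <= \val t)%R ->
    causal l (c s) (c t) /\
    l (c s) (c t) = (\val t - \val s)%:E * l (c I0) (c I1).

End causal_space.
Arguments I01 : clear implicits.

(* The carrier is pointed, hence nonempty, because the carrier of a
   measurableType is; there is no probability measure on the empty space. *)
Record synthetic_spacetime (R : realType) := SyntheticSpacetime {
  spacetime :> ptopologicalType ;
  ell : spacetime -> spacetime -> \bar R ;
  ell_causal : causal_space ell ;
  tau_polish : @polish R spacetime ;
  ell_usc : upper_semicontinuous
    (fun p : (spacetime * spacetime)%type => ell p.1 p.2) ;
  ell_lty : forall x y, (ell x y < +oo)%E ;
  ell_geodesic : forall x y, causal ell x y ->
    exists2 c : I01 R -> spacetime, geodesic ell c & c I0 = x /\ c I1 = y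
}.
Arguments ell {R s} _ _.

Section geodesics.
Context {R : realType} (X : synthetic_spacetime R).

Definition Geo_set : set {compact-open, I01 R -> X} := [set c | geodesic ell c].

Definition Geo : Type := Geo_set.

HB.instance Definition _ := Topological.on Geo.

Lemma Geo_nonempty : exists c : Geo, True.
Proof.
have [_ lxx _] := ell_causal X.
have [c gc _] := ell_geodesic (lxx (point : X)).
by exists (SigSub (mem_set gc : c \in Geo_set)).
Qed.

HB.instance Definition _ := isPointed.Build Geo (sval (cid Geo_nonempty)).

Definition ev (t : I01 R) : borel Geo -> borel X := fun c => set_val c t.

Definition ev01 : borel Geo -> borel (X * X)%type :=
  fun c => (ev I0 c, ev I1 c).

Lemma ev_continuous (t : I01 R) : continuous (ev t : Geo -> X).
Proof.
apply/continuousP => A oA.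
exists [set c : {compact-open, I01 R -> X} | c @` [set t] `<=` A].
  exact: compact_open_open (@compact_set1 _ t) oA.
by apply/seteqP; split => c /=; [apply; exists t | move=> At _ [_ -> <-]].
Qed.

Lemma ev01_continuous : continuous (ev01 : Geo -> (X * X)%type).
Proof.
move=> c; exact: cvg_pair (@ev_continuous I0 c) (@ev_continuous I1 c).
Qed.

HB.instance Definition _ t := isMeasurableFun.Build _ _ (borel Geo) (borel X)
  (ev t) (continuous_borel_measurable (@ev_continuous t)).

HB.instance Definition _ := isMeasurableFun.Build _ _ (borel Geo)
  (borel (X * X)%type) ev01 (continuous_borel_measurable ev01_continuous).

End geodesics.

Section generalized_sine.
Context {R : realType}.
Implicit Types (k : R) (f : R -> R).

Definition sin_ode k f : Prop :=
  [/\ forall x : R, derivable f x 1, forall x : R, derivable (derive1 f) x 1,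
      forall x : R, derive1 (derive1 f) x + k * f x = 0, f 0 = 0 & derive1 f 0 = 1].

Lemma sin_odeP k f (g : R -> R) :
  (forall x : R, is_derive x 1 f (g x)) -> (forall x : R, is_derive x 1 g (- k * f x)) ->
  f 0 = 0 -> g 0 = 1 -> sin_ode k f.
Proof.
move=> df dg f0 g0.
have fg : derive1 f = g by apply/funext => x; rewrite derive1E derive_val.
split=> //; rewrite ?fg // => x.
by rewrite derive1E derive_val mulNr addNr.
Qed.

Lemma sin_ode_exists k : exists f, sin_ode k f.
Proof.
have [k0|k0|->] := ltrgt0P k.
- set w := Num.sqrt k; have w0 : 0 < w by rewrite sqrtr_gt0.
  have wn : w != 0 by rewrite gt_eqF.
  have ww : k = w * w by rewrite -expr2 sqr_sqrtr// ltW.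
  exists (fun x => w^-1 * sin (w * x)).
  apply: (@sin_odeP _ _ (fun x => cos (w * x))).
  + move=> x; apply: is_derive_eq.
    by rewrite /GRing.scale/=; field.
  + move=> x; apply: is_derive_eq.
    by rewrite /GRing.scale/= ww; field.
  + by rewrite mulr0 sin0 mulr0.
  + by rewrite mulr0 cos0.
- set w := Num.sqrt (- k); have w0 : 0 < w by rewrite sqrtr_gt0 oppr_gt0.
  have wn : w != 0 by rewrite gt_eqF.
  have ww : k = - (w * w) by rewrite -expr2 sqr_sqrtr ?opprK// oppr_ge0 ltW.
  exists (fun x => w^-1 * (expR (w * x) - expR (- w * x)) / 2).
  apply: (@sin_odeP _ _ (fun x => (expR (w * x) + expR (- w * x)) / 2)).
  + move=> x; apply: is_derive_eq.
    by rewrite /GRing.scale/=; field.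
  + move=> x; apply: is_derive_eq.
    by rewrite /GRing.scale/= ww; field.
  + by rewrite !mulr0 subrr mulr0 mul0r.
  + by rewrite !mulr0 expR0; field.
- exists id; apply: (@sin_odeP _ _ (fun=> 1)) => // x.
  by apply: is_derive_eq; rewrite oppr0 mul0r.
Qed.

Lemma ode_uniq0 k f (g : R -> R) :
  (forall x : R, is_derive x 1 f (g x)) -> (forall x : R, is_derive x 1 g (- k * f x)) ->
  f 0 = 0 -> g 0 = 0 -> forall x, f x = 0.
Proof.
move=> df dg f0 g0 x.
have [k0|k0] := ltP 0 k.
- pose E y := g y * g y + k * (f y * f y).
  have dE (y : R) : is_derive y 1 E 0.
    by apply: is_derive_eq; rewrite /GRing.scale/=; ring.
  have := is_derive_0_is_cst x 0 dE; rewrite /E f0 g0 !mulr0 addr0.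
  have := sqr_ge0 (g x); rewrite expr2 => g1 h.
  have h2 : k * (f x * f x) = 0.
    have : 0 <= k * (f x * f x) by apply: mulr_ge0; [exact: ltW | rewrite -expr2 sqr_ge0].
    lra.
  by move/eqP: h2; rewrite !mulf_eq0 gt_eqF//= orbb => /eqP.
- set w := Num.sqrt (- k).
  have ww : k = - (w * w) by rewrite -expr2 sqr_sqrtr ?opprK// oppr_ge0.
  pose E y := (g y - w * f y) * expR (w * y).
  have dE (y : R) : is_derive y 1 E 0.
    by apply: is_derive_eq; rewrite /GRing.scale/= ww; ring.
  have gw y : g y = w * f y.
    have := is_derive_0_is_cst y 0 dE; rewrite /E f0 g0 !mulr0 subrr mul0r.
    by move/eqP; rewrite mulf_eq0 (gt_eqF (expR_gt0 _)) orbF subr_eq0 => /eqP.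
  pose F y := f y * expR (- w * y).
  have dF (y : R) : is_derive y 1 F 0.
    by apply: is_derive_eq; rewrite /GRing.scale/= gw; ring.
  have := is_derive_0_is_cst x 0 dF; rewrite /F f0 mul0r.
  by move/eqP; rewrite mulf_eq0 (gt_eqF (expR_gt0 _)) orbF => /eqP.
Qed.

Lemma sin_ode_uniq k f1 f2 : sin_ode k f1 -> sin_ode k f2 -> f1 = f2.
Proof.
move=> [d1 dd1 e1 z1 i1] [d2 dd2 e2 z2 i2]; apply/funext => x.
apply/eqP; rewrite -subr_eq0; apply/eqP.
apply: (@ode_uniq0 k (fun y => f1 y - f2 y) (fun y => derive1 f1 y - derive1 f2 y)).
- move=> y; rewrite !derive1E.
  by apply: is_deriveB; apply: derivableP.
- move=> y; have -> : - k * (f1 y - f2 y) = derive1 (derive1 f1) y - derive1 (derive1 f2) y.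
    by have := e1 y; have := e2 y; lra.
  by rewrite !(derive1E (derive1 _)); apply: is_deriveB; apply: derivableP.
- by rewrite z1 z2 subrr.
- by rewrite i1 i2 subrr.
Qed.

Definition sin_k k : R -> R := xget (fun=> 0) [set f | sin_ode k f].

Lemma sin_kP k : sin_ode k (sin_k k).
Proof.
rewrite /sin_k; case: xgetP => // no.
by have [f /no] := sin_ode_exists k.
Qed.

End generalized_sine.

Section distortion_coefficients.
Context {R : realType}.
Implicit Types (K N k t theta : R).

Definition sigma k t theta : \bar R :=
  if k * theta ^+ 2 < pi ^+ 2 then
    (if theta == 0 then t else sin_k k (t * theta) / sin_k k theta)%:E
  else +oo%E.

(* When t = 0 and sigma = +oo the product 0 * +oo is 0. *)
Definition tau K N t theta : \bar R :=
  ((t `^ N^-1)%:E * sigma (K / (N - 1)) t theta `^ (1 - N^-1))%E.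

End distortion_coefficients.

Section entropies.
Local Open Scope ereal_scope.
Context d (T : measurableType d) {R : realType}.
Variables (m : {measure set T -> \bar R}).
Implicit Types (mu : {measure set T -> \bar R}) (rho : T -> R).

Definition has_density mu rho : Prop :=
  [/\ measurable_fun [set: T] rho, forall x, (0 <= rho x)%R
    & forall B, measurable B -> mu B = \int[m]_(x in B) (rho x)%:E].

(* Lebesgue decomposition: mu = rho m + nu with nu and m mutually singular. *)
Definition has_ac_density mu rho : Prop :=
  [/\ measurable_fun [set: T] rho, forall x, (0 <= rho x)%R
    & exists (nu : {measure set T -> \bar R}) (Z : set T),
      [/\ measurable Z, m Z = 0, nu (~` Z) = 0
        & forall B, measurable B ->
            mu B = \int[m]_(x in B) (rho x)%:E + nu B]].

(* has_ac_density determines rho up to m-null sets, and some rho satisfies it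
   whenever m is sigma-finite, as a Radon measure on a Polish space is. *)
Definition S_ (N : R) mu : \bar R :=
  let rho := xget (cst 0%R) [set rho | has_ac_density mu rho] in
  - \int[m]_x (rho x `^ (1 - N^-1))%:E.

Definition Ent mu : \bar R :=
  if `[< exists rho, has_density mu rho >] then
    let rho := xget (cst 0%R) [set rho | has_density mu rho] in
    \int[m]_x (rho x * ln (rho x))%:E
  else +oo.

Definition U_ (N : R) mu : \bar R := expeR (- (Ent mu * N^-1%:E)).

End entropies.

Section optimal_transport.
Local Open Scope ereal_scope.
Context {R : realType} (X : synthetic_spacetime R).
Variable q : R.
Implicit Types (mu nu : probability (borel X) R)
  (pi : probability (borel (X * X)%type) R)
  (eta : probability (borel (Geo X)) R).

Definition coupling mu nu pi : Prop :=
  forall B : set (borel X), measurable B ->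
    pi (fst @^-1` B) = mu B /\ pi (snd @^-1` B) = nu B.

(* poweR sends -oo to 0, whereas here (-oo)^p = -oo. *)
Definition pow_Ny (a : \bar R) (p : R) : \bar R :=
  if a == -oo then -oo else a `^ p.

(* The integral of f is that of f^+ minus that of f^-, with +oo - +oo = -oo,
   so it is -oo as soon as pi gives positive mass to the pairs with
   ell = -oo. *)
Definition cost pi : \bar R :=
  pow_Ny (\int[pi]_p pow_Ny (ell p.1 p.2) q) q^-1.

Definition ell_q mu nu : \bar R :=
  ereal_sup [set cost pi | pi in [set pi | coupling mu nu pi]].

Definition Opt mu nu pi : Prop := coupling mu nu pi /\ cost pi = ell_q mu nu.

Definition TOpt mu nu pi : Prop :=
  Opt mu nu pi /\ {ae pi, forall p, chronological ell p.1 p.2}.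

Definition timelike_plan mu nu eta : Prop :=
  TOpt mu nu (distribution eta (@ev01 _ X)).

(* a and b may take the value +oo; they cannot take the value -oo because
   0 <= ell x x. *)
Definition dualizable mu nu : Prop :=
  exists a b : X -> \bar R,
  [/\ lower_semicontinuous a, lower_semicontinuous b,
      mu.-integrable [set: borel X] a, nu.-integrable [set: borel X] b
    & forall x y, ell x y <= a x + b y].

Definition timelike_pair mu nu : Prop :=
  dualizable mu nu /\ exists pi, TOpt mu nu pi.

End optimal_transport.

Section curvature_conditions.
Local Open Scope ereal_scope.
Context {R : realType} (X : synthetic_spacetime R).
Variable m : {measure set (borel X) -> \bar R}.
Implicit Types (mu nu : probability (borel X) R) (q K N t : R).

Definition globally_hyperbolic : Prop :=
  forall C1 C2 : set X, compact C1 -> compact C2 -> compact (diamond ell C1 C2).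

Definition measured : Prop := radon m /\ spt m = [set: X].

Definition Pc_ac mu : Prop := compact (spt mu : set X) /\ mu `<< m.

(* m_A = m(A)^-1 m|_A; the Dirac mass is a dummy, returned only when m(A) is
   0 or +oo. *)
Definition unif (A : set (borel X)) (mA : measurable A) :
    probability (borel X) R :=
  mnormalize (mrestr m mA) (dirac point).

(* c(0) and c(1) charge {rho0 = 0} and {rho1 = 0} with eta-mass 0, so the
   value of 0 `^ (- N'^-1) is irrelevant; likewise ell is positive and finite
   eta-almost everywhere, which makes fine harmless. *)
Definition TCD q K N : Prop :=
  forall mu0 mu1 (rho0 rho1 : X -> R),
  Pc_ac mu0 -> Pc_ac mu1 ->
  has_density m mu0 rho0 -> has_density m mu1 rho1 ->
  timelike_pair q mu0 mu1 ->
  exists2 eta : probability (borel (Geo X)) R, timelike_plan q mu0 mu1 eta &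
  forall N' (t : I01 R), (N < N')%R ->
  S_ m N' (distribution eta (ev t)) <=
  - \int[eta]_c
      let theta := fine (ell (ev I0 c) (ev I1 c)) in
      (tau K N' (1 - \val t) theta * (rho0 (ev I0 c) `^ (- N'^-1))%:E +
       tau K N' (\val t) theta * (rho1 (ev I1 c) `^ (- N'^-1))%:E).

(* Lambda is finite: mu0 and mu1 have compact support, and ell is upper
   semicontinuous and < +oo, hence bounded above on compact sets.  The same
   holds for Theta below. *)
Definition TCDe q K N : Prop :=
  forall mu0 mu1,
  Pc_ac mu0 -> Pc_ac mu1 -> timelike_pair q mu0 mu1 ->
  exists2 eta : probability (borel (Geo X)) R, timelike_plan q mu0 mu1 eta &
  let Lambda := fine ((\int[eta]_c ell (ev I0 c) (ev I1 c) ^+ 2) `^ 2^-1) in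
  forall t : I01 R,
  sigma (K / N) (1 - \val t) Lambda * U_ m N mu0 +
  sigma (K / N) (\val t) Lambda * U_ m N mu1 <=
  U_ m N (distribution eta (ev t)).

Definition Theta K (A B : set X) : R :=
  let E := [set ell_plus ell x y | x in A & y in B] in
  fine (if (0 <= K)%R then ereal_inf E else ereal_sup E).

Definition sTBM_with (coef : R -> R -> \bar R) q K N : Prop :=
  forall (A B : set (borel X)) (mA : measurable A) (mB : measurable B),
  compact (A : set X) -> compact (B : set X) ->
  0 < m A < +oo -> 0 < m B < +oo ->
  timelike_pair q (unif mA) (unif mB) ->
  exists2 eta : probability (borel (Geo X)) R,
    timelike_plan q (unif mA) (unif mB) eta &
  forall t : I01 R,
  coef (1 - \val t)%R (Theta K A B) * m A `^ N^-1 +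
  coef (\val t) (Theta K A B) * m B `^ N^-1 <=
  m (spt (distribution eta (ev t)) : set X) `^ N^-1.

Definition sTBM q K N : Prop := sTBM_with (tau K N) q K N.

Definition sTBM_star q K N : Prop := sTBM_with (sigma (K / N)) q K N.

End curvature_conditions.

(* Main.v *)
Require Import Defs.
From mathcomp Require Import all_boot all_order all_algebra.
From mathcomp Require Import all_classical all_reals all_analysis.
From mathcomp Require Import measurable_realfun ring lra.

Set Implicit Arguments.
Unset Strict Implicit.
Unset Printing Implicit Defensive.

Import Order.TTheory GRing.Theory Num.Theory.
Import numFieldNormedType.Exports.

Local Open Scope classical_set_scope.
Local Open Scope ring_scope.

(** A Brunn-Minkowski inequality is the curvature-dimension inequality read on
    uniform measures.  Let mu_t be the time t marginal of the plan that the
    curvature condition provides between the uniform measures of A and B.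

    On one side, among the measures carried by a set S, a Renyi or Boltzmann
    entropy is extremal at the uniform measure of S.  With S = spt mu_t, this
    bounds m(spt mu_t)^(1/N) from below by - S_N(mu_t), through the Hoelder
    inequality ([integral_powR_density_le]), and by U_N(mu_t), through the
    tangent inequality for x ln x ([integral_mul_ln_density_ge]).  A density of
    mu_t vanishes outside spt mu_t because mu_t gives full mass to its support
    ([negligible_sptC]).  These are [spt_S_ge] and [U_le_spt].  If the
    support has infinite measure, the inequality to be proved is trivial.

    On the other side, the densities at the endpoints are the constants 1/m(A)
    and 1/m(B), so that the right-hand side of the curvature condition already
    has the desired form, except that the coefficients are evaluated at
    ell(gamma_0, gamma_1), or at its quadratic mean, instead of Theta.  The
    coefficients are monotone in the distance, nondecreasing if K >= 0 and
    nonincreasing if K <= 0 ([sigma_curv_le], [tau_curv_le]), by the Wronskian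
    argument of [wronskian_ge0]; and Theta is the infimum, respectively the
    supremum, of the distances between A and B ([Theta_curv_le]).  So replacing
    the actual distances by Theta only decreases the right-hand side.

    The continuity of ell_+ serves to bound it on A x B, by which the supremum
    and the quadratic mean are finite. *)

(** * Supports in Polish spaces *)

Section polish_support.
Context {R : realType}.

Lemma polish_hausdorff (T : topologicalType) : @polish R T -> hausdorff_space T.
Proof.
move=> [_ [d [d0 dC dD nbhsd _]]] x y cxy; apply/d0/eqP; rewrite eq_le.
have d_ge0 : 0 <= d x y.
  have := dD x y x; rewrite (proj2 (d0 x x) erefl) (dC y x).
  by move=> ?; lra.
rewrite d_ge0 andbT leNgt; apply/negP => dxy.
have e0 : 0 < d x y / 2 by lra.
have /= := cxy [set z | d x z < d x y / 2] [set z | d y z < d x y / 2].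
case; [by apply/nbhsd; exists (d x y / 2)|by apply/nbhsd; exists (d x y / 2)|].
by move=> z [/= xz yz]; have := dD x z y; rewrite (dC z y); lra.
Qed.

Lemma open_borel (T : ptopologicalType) (A : set T) :
  open A -> measurable (A : set (borel T)).
Proof. by move=> oA; exact: sub_gen_smallest. Qed.

Lemma closed_borel (T : ptopologicalType) (A : set T) :
  closed A -> measurable (A : set (borel T)).
Proof.
move=> cA; rewrite -(setCK (A : set (borel T))); apply: measurableC.
by apply: open_borel; exact: closed_openC.
Qed.

Lemma closed_spt (T : topologicalType) (mu : set T -> \bar R) :
  closed (spt mu).
Proof.
rewrite -openC; have -> : ~` spt mu =
    \bigcup_(U in [set U | open U /\ ~ (0 < mu U)%E]) U.
  apply/seteqP; split => [x|x [U [oU mU] Ux] /(_ U oU Ux)//].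
  rewrite /= /spt /= => /existsNP[U /not_implyP[oU /not_implyP[Ux mU]]].
  by exists U.
by apply: bigcup_open => U [].
Qed.

Lemma measurable_spt (T : ptopologicalType) (mu : set T -> \bar R) :
  measurable (spt mu : set (borel T)).
Proof. by apply: closed_borel; exact: closed_spt. Qed.

(** By second countability: the complement of the support is a union of null
    open sets, hence a countable union of null balls with centres in a countable
    dense set and radii 1/(n+1). *)
Lemma negligible_sptC (T : ptopologicalType)
    (mu : {measure set (borel T) -> \bar R}) :
  @polish R T -> mu (~` spt (mu : set T -> \bar R)) = 0%E.
Proof.
move=> [[D cD dD] [d [d0 dC dT nbhsd _]]].
have dball x e : 0 < e -> open [set y : T | d x y < e].
  move=> e0; rewrite openE => y /= xy; apply/nbhsd.
  by exists (e - d x y); [lra|move=> z /= yz; have := dT x y z; lra].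
have /countable_injP [g ginj] := cD.
pose B (n : nat) p : set (borel T) := [set y | d p y < n.+1%:R^-1].
have i0 n : 0 < n.+1%:R^-1 :> R by rewrite invr_gt0.
have mB n p : measurable (B n p) by apply: open_borel; exact: dball.
(* As g is injective on D, F n k is empty or a single null ball. *)
pose F (n k : nat) : set (borel T) :=
  [set y | exists p, [/\ D p, g p = k, B n p y & mu (B n p) = 0%E]].
have nF n k : mu.-negligible (F n k).
  have [[p [Dp gp mp]]|noF] :=
      pselect (exists p, [/\ D p, g p = k & mu (B n p) = 0%E]).
    exists (B n p); split => // y [p' [Dp' gp' Bp' mp']].
    by rewrite (_ : p = p')//; apply: ginj; rewrite ?inE// gp gp'.
  exists set0; split => // y [p [Dp gp Bp mp]]; apply: noF.
  by exists p.
have : mu.-negligible (~` spt (mu : set T -> \bar R)).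
  apply: (@negligibleS _ _ _ _ (\bigcup_n \bigcup_k F n k)); last first.
    by apply: negligible_bigcup => n; exact: negligible_bigcup.
  move=> x; rewrite /= /spt /= => /existsNP[U /not_implyP[oU /not_implyP[Ux mU]]].
  have {}mU : mu U = 0%E.
    by apply/eqP; move/negP: mU; rewrite lt0e measure_ge0 andbT negbK.
  have /nbhsd[e e0 eU] : nbhs x U by exact: open_nbhs_nbhs.
  have e2 : 0 < e / 2 by lra.
  have [n ne] : exists n : nat, n.+1%:R^-1 < e / 2.
    have [n _ /(_ n (leqnn n))] := near_infty_natSinv_lt (PosNum e2).
    by move=> /= ?; exists n.
  have [||p [/= xp Dp]] := dD [set y | d x y < n.+1%:R^-1].
  - by exists x; rewrite /= (proj2 (d0 x x) erefl).
  - exact: dball.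
  exists n => //; exists (g p) => //; exists p; split => //.
    by rewrite /B /= dC.
  apply/eqP; rewrite eq_le measure_ge0 andbT -mU le_measure ?inE//.
    exact: open_borel.
  move=> y; rewrite /B /= => yp; apply: eU => /=.
    move: n.+1%:R^-1 ne xp yp => i ne xp yp.
    by have := dT x p y; lra.
by apply: measure_negligible; by apply: measurableC; exact: measurable_spt.
Qed.

End polish_support.

(** * Entropies of densities carried by a set *)

Section densities_carried_by_a_set.
Local Open Scope ereal_scope.
Context d (T : measurableType d) (R : realType).
Variables (m : {measure set T -> \bar R}) (S : set T) (rho : T -> R).
Hypotheses (mS : measurable S) (mrho : measurable_fun [set: T] rho).
Hypotheses (rho_ge0 : forall x, (0 <= rho x)%R).
Hypothesis rhoSC : \int[m]_(x in ~` S) (rho x)%:E = 0.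

Lemma density_ae0 : {ae m, forall x, ~ S x -> rho x = 0%R}.
Proof.
have mrhoE : measurable_fun (~` S) (fun x => (rho x)%:E).
  by apply/measurable_EFinP; exact: measurable_funTS.
have /(ae_eq_integral_abs m (measurableC mS) mrhoE) h :
    \int[m]_(x in ~` S) `|(rho x)%:E| = 0.
  by rewrite -rhoSC; apply: eq_integral => x _ /=; rewrite ger0_norm.
by apply: filterS h => x /= h Sx; have [] := h Sx.
Qed.

(** A density of a measure carried by S vanishes a.e. outside S, so that an
    entropy integrand, which is 0 where the density is, only counts on S. *)
Lemma integral_density_set (phi : R -> R) :
  measurable_fun [set: R] phi -> phi 0%R = 0%R ->
  \int[m]_x (phi (rho x))%:E = \int[m]_(x in S) (phi (rho x))%:E.
Proof.
move=> mphi phi0; rewrite [RHS]integral_mkcond; apply: ae_eq_integral => //.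
- by apply/measurable_EFinP; exact: measurableT_comp.
- apply/(measurable_restrictT _ mS).1/measurable_EFinP.
  by apply: measurable_funTS; exact: measurableT_comp.
- apply: filterS density_ae0 => x /= h _.
  by rewrite patchE; case: ifPn => // /negP; rewrite inE => /h ->; rewrite phi0.
Qed.

Hypothesis rho1 : \int[m]_x (rho x)%:E <= 1.

(** Hoelder inequality for rho^(1-1/N) and the indicator of S, with exponents
    1/(1-1/N) and N. *)
Lemma integral_powR_density_le (N : R) : (1 < N)%R ->
  \int[m]_x (rho x `^ (1 - N^-1))%:E <= m S `^ N^-1.
Proof.
move=> N1; have N0 : (0 < N)%R by rewrite (lt_trans _ N1).
set p := (1 - N^-1)%R.
have p0 : (0 < p)%R by rewrite subr_gt0 invf_lt1.
have mf : measurable_fun [set: T] (fun x => rho x `^ p)%R.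
  by apply: (measurableT_comp (@measurable_powR R p)).
have mg : measurable_fun [set: T] (\1_S : T -> R) by [].
have pN : (p^-1^-1 + N^-1 = 1)%R by rewrite invrK subrK.
have pV0 : (0 < p^-1)%R by rewrite invr_gt0.
have := hoelder m mf mg pV0 N0 pN.
rewrite Lnorm1 !unlock.
have -> : \int[m]_x `|(EFin \o ((fun x => rho x `^ p) \* \1_S)%R) x| =
    \int[m]_x (rho x `^ p)%:E.
  have -> := @integral_density_set (fun y => y `^ p)%R (@measurable_powR R p)
    (powR0 (negbT (gt_eqF p0))).
  rewrite [RHS]integral_mkcond; apply: eq_integral => x _ /=.
  rewrite patchE indicE; case: ifPn => _; rewrite ?mulr1 ?mulr0 ?normr0//.
  by rewrite ger0_norm ?powR_ge0.
have -> : \int[m]_x `|(EFin \o (fun x => rho x `^ p)%R) x| `^ p^-1 =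
    \int[m]_x (rho x)%:E.
  apply: eq_integral => x _ /=.
  by rewrite ger0_norm ?powR_ge0// -powRrM mulfV ?gt_eqF// powRr1.
have -> : \int[m]_x `|(EFin \o (\1_S : T -> R)) x| `^ N = m S.
  transitivity (\int[m]_x (\1_S x)%:E); last by rewrite integral_indic// setIT.
  apply: eq_integral => x _ /=.
  rewrite indicE; case: (x \in S); rewrite ?normr1 ?powR1// normr0 powR0//.
  by rewrite gt_eqF.
move=> /le_trans; apply; rewrite -[leRHS]mul1e; apply: lee_wpmul2r.
  exact: poweR_ge0.
rewrite invrK; apply: (@le_trans _ _ (1 `^ p)); last by rewrite poweR_EFin powR1.
apply: gt0_ler_poweR => //; first exact: ltW.
- by rewrite in_itv/= leey andbT integral_ge0// => x _; rewrite lee_fin.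
- by rewrite in_itv/= leey lee01.
Qed.

End densities_carried_by_a_set.

(** For functions that may fail to be integrable: the positive and negative
    parts are compared separately, and a difference in the extended reals is
    monotone even when it reads oo - oo. *)
Lemma le_integral_measurable d (T : measurableType d) (R : realType)
    (m : {measure set T -> \bar R}) (D : set T) (f g : T -> \bar R) :
  measurable D -> measurable_fun D f -> measurable_fun D g ->
  (forall x, D x -> f x <= g x)%E ->
  (\int[m]_(x in D) f x <= \int[m]_(x in D) g x)%E.
Proof.
move=> mD mf mg fg; rewrite integralE [leRHS]integralE; apply: leeB.
- apply: ge0_le_integral => //; try exact: measurable_funepos.
  by move=> x Dx; rewrite !funeposE le_max2// fg.
- apply: ge0_le_integral => //; try exact: measurable_funeneg.
  by move=> x Dx; rewrite !funenegE le_max2// leeN2 fg.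
Qed.

(** The convex function x ln x lies above its tangent line at a; the value
    0 ln 0 is 0. *)
Lemma mul_ln_ge_tangent (R : realType) (a x : R) : 0 < a -> 0 <= x ->
  x * (ln a + 1) - a <= x * ln x.
Proof.
move=> a0; rewrite le_eqVlt => /predU1P[<-|x0].
  by rewrite !mul0r sub0r oppr_le0 ltW.
have ax : 0 < a / x by rewrite divr_gt0.
have h : ln (a / x) <= a / x - 1.
  have -> : a / x = 1 + (a / x - 1) by ring.
  by rewrite [leRHS](_ : _ = a / x - 1) ?le_ln1Dx; lra.
have : x * ln (a / x) <= x * (a / x - 1) by rewrite ler_pM2l.
rewrite ln_div ?posrE// [in leRHS]mulrBr (mulrC x (a / x)) divfK ?gt_eqF//.
by rewrite mulrBr; lra.
Qed.

Section entropy_of_densities.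
Local Open Scope ereal_scope.
Context d (T : measurableType d) (R : realType).
Variables (m : {measure set T -> \bar R}) (S : set T) (rho : T -> R).
Hypotheses (mS : measurable S) (mrho : measurable_fun [set: T] rho).
Hypotheses (rho_ge0 : forall x, (0 <= rho x)%R).
Hypothesis rhoSC : \int[m]_(x in ~` S) (rho x)%:E = 0.
Hypothesis rho1 : \int[m]_x (rho x)%:E = 1.

Lemma measurable_mul_ln : measurable_fun [set: R] (fun y : R => y * ln y)%R.
Proof. by apply: measurable_funM => //; exact: measurable_ln. Qed.

(** Jensen inequality for x ln x: integrate the tangent inequality at the mean
    value 1/m(S) of rho over S. *)
Lemma integral_mul_ln_density_ge : 0 < m S < +oo ->
  (- ln (fine (m S)))%:E <= \int[m]_x (rho x * ln (rho x))%:E.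
Proof.
move=> /andP[S0 Soo]; set M := fine (m S).
have MS : m S = M%:E by rewrite fineK// ge0_fin_numE// ltW.
have M0 : (0 < M)%R by rewrite -lte_fin -MS.
have -> := @integral_density_set _ _ _ m S rho mS mrho rho_ge0 rhoSC
  (fun y => y * ln y)%R measurable_mul_ln (mul0r _).
have rhoS : \int[m]_(x in S) (rho x)%:E = 1.
  rewrite -rho1; apply/esym.
  exact: (@integral_density_set _ _ _ m S rho mS mrho rho_ge0 rhoSC id).
have irho : m.-integrable S (EFin \o rho).
  apply/integrableP; split.
    by apply/measurable_EFinP; exact: measurable_funTS.
  under eq_integral => x _ do rewrite /= ger0_norm//.
  by rewrite rhoS ltry.
have -> : (- ln M)%:E = \int[m]_(x in S) (rho x * (ln M^-1 + 1) - M^-1)%:E.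
  under eq_integral do rewrite EFinB EFinM.
  rewrite integralB//=; last 2 first.
  - exact: integrableZr.
  - apply/integrableP; split; first exact: measurable_cst.
    by rewrite [ltLHS](integral_cst m mS `|M^-1%:E|) MS -EFinM ltry.
  rewrite integralZr// rhoS mul1e integral_cst// MS -EFinM mulVf ?gt_eqF//.
  by rewrite lnV ?posrE// -EFinB; congr EFin; lra.
apply: le_integral_measurable => //.
- apply/measurable_EFinP/measurable_funB => //; apply: measurable_funM => //.
  exact: measurable_funTS.
- apply/measurable_EFinP/measurable_funTS.
  by apply: (measurableT_comp measurable_mul_ln).
- by move=> x _; rewrite lee_fin; apply: mul_ln_ge_tangent; rewrite ?invr_gt0.
Qed.

End entropy_of_densities.

(** * Measure of the support and entropy *)

Section support_bounds.
Local Open Scope ereal_scope.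
Context (R : realType) (T : ptopologicalType).
Hypothesis polT : @polish R T.
Variables (m : {measure set (borel T) -> \bar R}) (mu : probability (borel T) R).
Variable N : R.

(** The bound covers both branches of S_: a Lebesgue density of mu, and the
    default 0 when there is none, satisfy the same two integral conditions. *)
Lemma spt_S_ge : (1 < N)%R ->
  - (m (spt (mu : set T -> \bar R)) `^ N^-1) <= S_ m N mu.
Proof.
move=> N1; rewrite /S_ leeN2.
set S := spt _; have mS : measurable (S : set (borel T)) := measurable_spt _.
have muS : mu (~` S) = 0 := negligible_sptC mu polT.
case: xgetP => [rho _ [mrho rho0 [nu [Z [_ _ _ murho]]]]|_]; last first.
  apply: (@integral_powR_density_le _ _ _ m S (cst 0%R)) => //.
  - by rewrite integral0.
  - by rewrite integral0.
have le_mu B : measurable B -> \int[m]_(x in B) (rho x)%:E <= mu B.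
  by move=> mB; rewrite murho// leeDl.
apply: integral_powR_density_le => //.
- apply/eqP; rewrite eq_le integral_ge0 ?andbT; last by move=> x _; rewrite lee_fin.
  by rewrite -muS; apply: le_mu; exact: measurableC.
- by rewrite (le_trans (le_mu _ measurableT))// probability_setT.
Qed.

(** A support of infinite measure makes the bound trivial.  That case has to be
    set apart, since Ent could then be an integral of the form oo - oo, read as
    -oo. *)
Lemma U_le_spt : (0 < N)%R ->
  U_ m N mu <= m (spt (mu : set T -> \bar R)) `^ N^-1.
Proof.
move=> N0; have NV0 : (0 < N^-1)%R by rewrite invr_gt0.
rewrite /U_ /Ent.
set S := spt _; have mS : measurable (S : set (borel T)) := measurable_spt _.
have muS : mu (~` S) = 0 := negligible_sptC mu polT.
have [mSoo|mSoo] := eqVneq (m S) +oo.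
  by rewrite mSoo poweRyr ?gt_eqF// leey.
case: asboolP => [[rho' hrho']|_]; last first.
  by rewrite gt0_mulye ?lte_fin// ?poweR_ge0.
case: xgetP => [rho _ [mrho rho0 murho]|/(_ rho')//].
have {}murho B : measurable B -> mu B = \int[m]_(x in B) (rho x)%:E := murho B.
have rhoT : \int[m]_x (rho x)%:E = 1.
  by rewrite -[RHS](probability_setT mu) murho.
have rhoSC : \int[m]_(x in ~` S) (rho x)%:E = 0.
  by rewrite -muS murho//; exact: measurableC.
have mS0 : 0 < m S.
  rewrite lt0e measure_ge0 andbT; apply/eqP => mS0.
  have := @integral_density_set _ _ _ m S rho mS mrho rho0 rhoSC id
    (@measurable_id _ _ _) erefl.
  rewrite /= rhoT null_set_integral//; last first.
    by apply/measurable_EFinP; exact: measurable_funTS.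
  by move/eqP; rewrite onee_eq0.
have mSfin : 0 < m S < +oo by rewrite mS0 ltey.
have := integral_mul_ln_density_ge mS mrho rho0 rhoSC rhoT mSfin.
have [M MS] : exists M, m S = M%:E.
  by exists (fine (m S)); rewrite fineK// ge0_fin_numE// ltey.
have M0 : (0 < M)%R by rewrite -lte_fin -MS.
rewrite MS /= => h; rewrite /powR gt_eqF//.
rewrite -[leRHS]/(expeR (N^-1 * ln M)%:E) lee_expeR leeNl mulrC.
by rewrite -EFinN -mulNr EFinM lee_wpmul2r// lee_fin ltW.
Qed.

End support_bounds.

(** * Monotonicity of the distortion coefficients *)

Section distortion_coefficients_monotone.
Context {R : realType}.
Implicit Types (K N k t : R).

Local Notation cos_k k := (derive1 (sin_k k)).

Lemma sin_kE k (f : R -> R) : sin_ode k f -> sin_k k = f.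
Proof. exact: sin_ode_uniq (sin_kP k). Qed.

Lemma sin_k_gt0 k x : 0 < x -> k * x ^+ 2 < pi ^+ 2 -> 0 < sin_k k x.
Proof.
move=> x0 kx; have [k0|k0|->] := ltrgt0P k.
- set w := Num.sqrt k; have w0 : 0 < w by rewrite sqrtr_gt0.
  have ww : k = w * w by rewrite -expr2 sqr_sqrtr// ltW.
  rewrite (@sin_kE k (fun x => w^-1 * sin (w * x))); last first.
    apply: (@sin_odeP _ _ _ (fun x => cos (w * x))) => [y|y||].
    + by apply: is_derive_eq; rewrite /GRing.scale/=; field; rewrite gt_eqF.
    + by apply: is_derive_eq; rewrite /GRing.scale/= ww; field; rewrite gt_eqF.
    + by rewrite mulr0 sin0 mulr0.
    + by rewrite mulr0 cos0.
  rewrite mulr_gt0 ?invr_gt0// sin_gt0_pi// mulr_gt0//=.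
  rewrite -(@ltr_pXn2r _ 2)// ?nnegrE ?pi_ge0 ?mulr_ge0 ?ltW//.
  by rewrite exprMn [w ^+ 2]expr2 -ww.
- set w := Num.sqrt (- k); have w0 : 0 < w by rewrite sqrtr_gt0 oppr_gt0.
  have ww : k = - (w * w) by rewrite -expr2 sqr_sqrtr ?opprK// oppr_ge0 ltW.
  rewrite (@sin_kE k (fun x => w^-1 * (expR (w * x) - expR (- w * x)) / 2)).
    rewrite !mulr_gt0 ?invr_gt0// subr_gt0 ltr_expR mulNr.
    by have := mulr_gt0 w0 x0; lra.
  apply: (@sin_odeP _ _ _ (fun x => (expR (w * x) + expR (- w * x)) / 2)) => [y|y||].
  + by apply: is_derive_eq; rewrite /GRing.scale/=; field; rewrite gt_eqF.
  + by apply: is_derive_eq; rewrite /GRing.scale/= ww; field; rewrite gt_eqF.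
  + by rewrite !mulr0 subrr mulr0 mul0r.
  + by rewrite !mulr0 expR0; field.
- rewrite (@sin_kE 0 id)//; apply: (@sin_odeP _ _ _ (fun=> 1)) => // y.
  by apply: is_derive_eq; rewrite oppr0 mul0r.
Qed.

Lemma sin_k0 k : sin_k k 0 = 0. Proof. by have [] := sin_kP k. Qed.

Lemma is_derive_sin_k k (x : R) : is_derive x 1 (sin_k k) (cos_k k x).
Proof.
have [ds _ _ _ _] := sin_kP k.
by rewrite derive1E; apply: derivableP.
Qed.

Lemma is_derive_cos_k k (x : R) : is_derive x 1 (cos_k k) (- k * sin_k k x).
Proof.
have [_ dc ode _ _] := sin_kP k.
have -> : - k * sin_k k x = derive1 (cos_k k) x by have := ode x; lra.
by rewrite (derive1E (cos_k k)); apply: derivableP.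
Qed.

(** The derivative is prescribed on [a, b] only, as a quotient by sin_k is
    differentiable only before the first zero of sin_k. *)
Lemma is_derive_ndecr (f g : R -> R) (a b : R) : a <= b ->
  (forall x : R, a <= x <= b -> is_derive x 1 f (g x)) ->
  (forall x, a < x < b -> 0 <= g x) -> f a <= f b.
Proof.
move=> ab df g0; apply: (@ger0_derive1_ndecr _ f a b) => // [x|x|].
- rewrite in_itv/= => /andP[ax xb].
  by have [] := df x (introT andP (conj (ltW ax) (ltW xb))).
- rewrite in_itv/= => axb; have /andP[ax xb] := axb.
  have dfx := df x (introT andP (conj (ltW ax) (ltW xb))).
  by rewrite derive1E derive_val g0.
- apply: derivable_within_continuous => x; rewrite in_itv/= => /df dfx.
  by have [] := dfx.
Qed.

Lemma below_pole k (x y : R) : 0 <= x <= y -> k * y ^+ 2 < pi ^+ 2 ->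
  k * x ^+ 2 < pi ^+ 2.
Proof.
move=> /andP[x0 xy] ky; have [k0|k0] := leP k 0.
  apply: (@le_lt_trans _ _ 0); last by rewrite exprn_gt0// pi_gt0.
  by rewrite mulr_le0_ge0// sqr_ge0.
apply: le_lt_trans ky; rewrite ler_pM2l// ler_pXn2r// nnegrE//.
exact: le_trans xy.
Qed.

Lemma sin_k_ge0 k x : 0 <= x -> k * x ^+ 2 < pi ^+ 2 -> 0 <= sin_k k x.
Proof.
rewrite le_eqVlt => /predU1P[<- _|x0 kx]; first by rewrite sin_k0.
exact/ltW/sin_k_gt0.
Qed.

Lemma is_derive_sin_kM k t (x : R) :
  is_derive x 1 (fun y => sin_k k (t * y)) (t * cos_k k (t * x)).
Proof.
have ds := is_derive_sin_k k (t * x).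
by apply: is_derive_eq; rewrite /GRing.scale/=; ring.
Qed.

Lemma is_derive_cos_kM k t (x : R) :
  is_derive x 1 (fun y => cos_k k (t * y)) (t * (- k * sin_k k (t * x))).
Proof.
have ds := is_derive_cos_k k (t * x).
by apply: is_derive_eq; rewrite /GRing.scale/=; ring.
Qed.


(** The Wronskian of x |-> sin_k(t x) and sin_k vanishes at 0, and the equation
    f'' = - k f makes its derivative k (1 - t^2) sin_k(t x) sin_k(x), of the sign
    of k.  The factor e, later 1 or -1, treats both signs of k at once. *)
Lemma wronskian_ge0 (e k t x : R) : 0 <= e * k -> 0 <= t <= 1 -> 0 <= x ->
  k * x ^+ 2 < pi ^+ 2 ->
  0 <= e * (t * cos_k k (t * x) * sin_k k x - sin_k k (t * x) * cos_k k x).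
Proof.
move=> ek /andP[t0 t1] x0 kx.
pose W y := e * (t * cos_k k (t * y) * sin_k k y - sin_k k (t * y) * cos_k k y).
have W0 : W 0 = 0 by rewrite /W mulr0 sin_k0 mulr0 mul0r subrr mulr0.
rewrite -[leLHS]W0 -/(W x).
apply: (@is_derive_ndecr _
  (fun y => e * k * (1 - t ^+ 2) * (sin_k k (t * y) * sin_k k y))) => // y.
  move=> _; rewrite /W.
  have ds := is_derive_sin_k k y; have dc := is_derive_cos_k k y.
  have dst := is_derive_sin_kM k t y; have dct := is_derive_cos_kM k t y.
  by apply: is_derive_eq; rewrite /GRing.scale/=; ring.
move=> /andP[y0 yx].
have ky : k * y ^+ 2 < pi ^+ 2 by rewrite (@below_pole _ _ x)// !ltW.
apply: mulr_ge0; last apply: mulr_ge0.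
- by rewrite mulr_ge0// subr_ge0 expr_le1.
- apply: sin_k_ge0; first by rewrite mulr_ge0// ltW.
  by apply: (@below_pole _ _ y) => //; rewrite mulr_ge0 ?ler_piMl// ltW.
- by apply: sin_k_ge0 => //; exact: ltW.
Qed.

(** The derivative of the ratio is the Wronskian over sin_k^2. *)
Lemma sin_k_ratio_mono (e k t a b : R) : 0 <= e * k -> 0 <= t <= 1 ->
  0 < a -> a <= b -> k * b ^+ 2 < pi ^+ 2 ->
  e * (sin_k k (t * a) / sin_k k a) <= e * (sin_k k (t * b) / sin_k k b).
Proof.
move=> ek t01 a0 ab kb.
pose h y := e * (sin_k k (t * y) / sin_k k y).
pose W y := e * (t * cos_k k (t * y) * sin_k k y - sin_k k (t * y) * cos_k k y).
rewrite -/(h a) -/(h b).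
apply: (@is_derive_ndecr h (fun y => W y / sin_k k y ^+ 2)) => // y.
  move=> /andP[ay yb].
  have y0 : 0 < y by exact: lt_le_trans ay.
  have sy : sin_k k y != 0.
    by rewrite gt_eqF// sin_k_gt0// (@below_pole _ _ b)// (ltW y0).
  have ds := is_derive_sin_k k y; have dst := is_derive_sin_kM k t y.
  have dV := is_deriveV sy.
  rewrite /h; apply: is_derive_eq; rewrite /GRing.scale/= /W.
  by field.
move=> /andP[ay yb]; have y0 : 0 < y by exact: lt_trans ay.
have ky : k * y ^+ 2 < pi ^+ 2 by rewrite (@below_pole _ _ b)// !ltW.
by apply: divr_ge0; [apply: wronskian_ge0 => //; exact: ltW|exact: sqr_ge0].
Qed.

(** The comparison with the value t of the ratio at 0, where the quotient is not
    defined: sin_k(t x) - t sin_k(x) vanishes at 0 and has derivative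
    t (cos_k(t x) - cos_k(x)), where cos_k = sin_k' is monotone because
    cos_k' = - k sin_k. *)
Lemma sin_k_ratio_ge (e k t b : R) : 0 <= e * k -> 0 <= t <= 1 ->
  0 < b -> k * b ^+ 2 < pi ^+ 2 ->
  e * t <= e * (sin_k k (t * b) / sin_k k b).
Proof.
move=> ek /andP[t0 t1] b0 kb; have sb := sin_k_gt0 b0 kb.
rewrite mulrA ler_pdivlMr// -mulrA -subr_ge0 -mulrBr.
pose V y := e * (sin_k k (t * y) - t * sin_k k y).
have V0 : V 0 = 0 by rewrite /V mulr0 sin_k0 mulr0 subrr mulr0.
rewrite -[leLHS]V0 -/(V b).
apply: (@is_derive_ndecr _
  (fun y => t * (e * (cos_k k (t * y) - cos_k k y)))) => // [|y _|y /andP[y0 yb]].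
- exact: ltW.
- rewrite /V; have ds := is_derive_sin_k k y; have dst := is_derive_sin_kM k t y.
  by apply: is_derive_eq; rewrite /GRing.scale/=; ring.
have ky : k * y ^+ 2 < pi ^+ 2 by rewrite (@below_pole _ _ b)// !ltW.
apply: mulr_ge0 => //; rewrite mulrBr subr_ge0 -lerN2 -!mulrN.
apply: (@is_derive_ndecr (fun x => e * - cos_k k x)
  (fun x => e * k * sin_k k x)) => [|x _|x /andP[x0 xy]].
- by rewrite ler_piMl// ltW.
- have dc := is_derive_cos_k k x.
  by apply: is_derive_eq; rewrite /GRing.scale/=; ring.
have {}x0 : 0 <= x by rewrite (le_trans _ (ltW x0))// mulr_ge0// ltW.
by rewrite mulr_ge0// sin_k_ge0// (@below_pole _ _ y)// x0 ltW.
Qed.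

Definition sin_ratio k t x := if x == 0 then t else sin_k k (t * x) / sin_k k x.

Lemma sin_ratio_mono (e k t a b : R) : 0 <= e * k -> 0 <= t <= 1 ->
  0 <= a -> a <= b -> k * b ^+ 2 < pi ^+ 2 ->
  e * sin_ratio k t a <= e * sin_ratio k t b.
Proof.
move=> ek t01; rewrite le_eqVlt => /predU1P[<-|a0] ab kb; rewrite /sin_ratio.
  rewrite eqxx; have [//|b0] := eqVneq b 0.
  by apply: sin_k_ratio_ge => //; rewrite lt_neqAle eq_sym b0.
by rewrite !gt_eqF ?(lt_le_trans a0 ab)//; exact: sin_k_ratio_mono.
Qed.

Lemma sigma_ge0 k t x : 0 <= t <= 1 -> 0 <= x -> (0 <= sigma k t x)%E.
Proof.
move=> /andP[t0 t1] x0; rewrite /sigma; case: ifPn => [kx|_]; last exact: leey.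
rewrite lee_fin; case: ifPn => // _.
rewrite divr_ge0 ?sin_k_ge0 ?mulr_ge0// (@below_pole _ _ x)//.
by rewrite mulr_ge0 ?ler_piMl.
Qed.

(** The order on distances for which the coefficients of curvature K are
    nondecreasing: the usual one if K >= 0, its converse if K < 0.  Theta is the
    greatest lower bound, for it, of the distances between two sets. *)
Definition curv_le K (a b : R) : bool :=
  if 0 <= K then 0 <= a <= b else 0 <= b <= a.

Lemma curv_le_ge0 K (a b : R) : curv_le K a b -> 0 <= a /\ 0 <= b.
Proof.
by rewrite /curv_le; case: ifP => _ /andP[h0 h]; split=> //; exact: le_trans h.
Qed.

Lemma curv_le_div K c (a b : R) : 0 < c -> curv_le (K / c) a b = curv_le K a b.
Proof. by move=> c0; rewrite /curv_le pmulr_lge0 ?invr_gt0. Qed.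

Lemma sigma_curv_le k t a b : 0 <= t <= 1 -> curv_le k a b ->
  (sigma k t a <= sigma k t b)%E.
Proof.
move=> t01; rewrite /curv_le; case: leP => k0 /andP[x0 xy].
  rewrite [leRHS]/sigma; case: ifPn => [kb|_]; last exact: leey.
  rewrite /sigma (@below_pole _ _ b) ?x0// lee_fin.
  by rewrite -[leLHS]mul1r -[leRHS]mul1r; apply: sin_ratio_mono; rewrite ?mul1r.
have kneg x : k * x ^+ 2 < pi ^+ 2.
  apply: (@le_lt_trans _ _ 0); last by rewrite exprn_gt0// pi_gt0.
  by rewrite mulr_le0_ge0 ?sqr_ge0// ltW.
rewrite /sigma !kneg lee_fin -lerN2 -[leLHS]mulN1r -[leRHS]mulN1r.
by apply: sin_ratio_mono => //; rewrite mulN1r oppr_ge0 ltW.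
Qed.

Lemma tau_ge0 K N t x : (0 <= tau K N t x)%E.
Proof. by rewrite mule_ge0 ?poweR_ge0// lee_fin powR_ge0. Qed.

Lemma tau_curv_le K N t a b : 1 < N -> 0 <= t <= 1 -> curv_le K a b ->
  (tau K N t a <= tau K N t b)%E.
Proof.
move=> N1 t01 ab; have N0 : 0 < N by exact: lt_trans N1.
have [a0 b0] := curv_le_ge0 ab.
apply: lee_wpmul2l; first by rewrite lee_fin powR_ge0.
apply: gt0_ler_poweR => //; first by rewrite subr_ge0 invf_le1// ltW.
- by rewrite in_itv/= leey sigma_ge0.
- by rewrite in_itv/= leey sigma_ge0.
- by apply: sigma_curv_le => //; rewrite curv_le_div// subr_gt0.
Qed.

End distortion_coefficients_monotone.

(** * Uniform measures *)

Section integral_bounds.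
Import HBNNSimple.
Local Open Scope ereal_scope.
Context d (T : measurableType d) (R : realType) (mu : probability T R).
Implicit Types (f : T -> \bar R) (c : \bar R).

(** For functions that may fail to be measurable: the integral of a nonnegative
    function is a supremum over the simple functions below it.  This spares
    checking it for the integrands of the curvature conditions. *)
Lemma ae_ge_cst_integral f c : (forall x, 0 <= f x) -> 0 <= c ->
  {ae mu, forall x, c <= f x} -> c <= \int[mu]_x f x.
Proof.
move=> f0 c0 [N [mN N0 subN]].
have mNC := measurableC mN.
have gf x : (cst c \_ (~` N)) x <= f x.
  rewrite patchE; case: ifPn => // /set_mem Nx.
  by apply: contrapT => cf; apply/Nx/subN.
have g0 x : 0 <= (cst c \_ (~` N)) x by rewrite patchE; case: ifP.
have <- : \int[mu]_x (cst c \_ (~` N)) x = c.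
  have muNC : mu (~` N) = 1 by rewrite probability_setC// [mu N]N0 sube0.
  by rewrite -integral_mkcond integral_cst// -[RHS]mule1 -muNC.
rewrite !ge0_integralTE//; apply: le_ereal_sup => _ /= [h hg <-].
by exists h => // x; exact: le_trans (hg x) (gf x).
Qed.

Lemma ae_le_cst_integral f c : (forall x, 0 <= f x) -> 0 <= c ->
  {ae mu, forall x, f x <= c} -> \int[mu]_x f x <= c.
Proof.
move=> f0 c0 fc; rewrite ge0_integralTE//; apply: ge_ereal_sup => _ /= [h hf <-].
rewrite -integralT_nnsfun.
have -> : c = \int[mu]_x cst c x by rewrite integral_cst// -[LHS]mule1 -(probability_setT mu).
apply: ae_ge0_le_integral => //.
- by move=> x _; rewrite lee_fin; exact: fun_ge0.
- by apply/measurable_EFinP; exact: measurable_funPT.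
- by apply: filterS fc => x fxc _; exact: le_trans (hf x) fxc.
Qed.

End integral_bounds.

Section uniform_measure.
Local Open Scope ereal_scope.
Context (R : realType) (X : synthetic_spacetime R).
Variables (m : {measure set (borel X) -> \bar R}) (A : set (borel X)).
Hypotheses (mA : measurable A) (mA0 : 0 < m A < +oo).

Lemma fin_measure : m A = (fine (m A))%:E.
Proof. by have /andP[m0 moo] := mA0; rewrite fineK// ge0_fin_numE// ltW. Qed.

Lemma fine_measure_gt0 : (0 < fine (m A))%R.
Proof. by rewrite -lte_fin -fin_measure; have /andP[] := mA0. Qed.

Lemma unifE (B : set (borel X)) :
  unif m mA B = m (B `&` A) * (fine (m A))^-1%:E.
Proof.
have /andP[m0 moo] := mA0.
have mT : m ([set: borel X] `&` A) = m A by rewrite setTI.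
rewrite /unif /= /mnormalize; case: ifPn => [h|_]; last by rewrite -mT.
have : (m ([set: borel X] `&` A) == 0) || (m ([set: borel X] `&` A) == +oo) := h.
by rewrite mT (gt_eqF m0) (lt_eqF moo).
Qed.

Lemma unif_setC : unif m mA (~` A) = 0.
Proof. by rewrite unifE setICl measure0 mul0e. Qed.

Definition unif_density (x : borel X) : R := (\1_A x * (fine (m A))^-1)%R.

Lemma unif_has_density : has_density m (unif m mA) unif_density.
Proof.
split=> [|x|B mB].
- by apply: measurable_funM.
- by rewrite /unif_density mulr_ge0// invr_ge0 ltW// fine_measure_gt0.
- apply: (etrans (unifE B)); rewrite setIC -(integral_indic m mB mA).
  under [RHS]eq_integral do rewrite /unif_density EFinM.
  rewrite ge0_integralZr ?lee_fin ?invr_ge0 ?(ltW fine_measure_gt0)//.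
  by apply/measurable_EFinP.
Qed.

Lemma unif_Pc_ac : compact (A : set X) -> Pc_ac m (unif m mA).
Proof.
move=> cA; split.
- apply: (subclosed_compact _ cA); first exact: closed_spt.
  move=> x sx; apply: contrapT => Ax.
  have oAC : open (~` (A : set X)).
    apply: closed_openC; apply: compact_closed cA.
    exact: polish_hausdorff (tau_polish X).
  by have : 0 < unif m mA (~` A) := sx _ oAC Ax; rewrite unif_setC ltxx.
- move=> B mB0 C mC CB; apply: (etrans (unifE C)).
  have -> : m (C `&` A) = 0.
    by apply: mB0 => //; [exact: measurableI|exact: subset_trans CB].
  by rewrite mul0e.
Qed.

(** Ent is computed with an arbitrary density, which agrees almost everywhere with
    the constant 1/m(A) on A. *)
Lemma U_unif_ge (N : R) : (0 < N)%R -> m A `^ N^-1 <= U_ m N (unif m mA).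
Proof.
move=> N0; set M := fine (m A).
have M0 : (0 < M)%R := fine_measure_gt0.
rewrite /U_ /Ent; case: asboolP; last by case; exists unif_density; exact: unif_has_density.
move=> _; case: xgetP => [rho _ [mrho rho0 murho]|/(_ _ unif_has_density)//].
have [mun un0 muun] := unif_has_density.
have rhoT : \int[m]_x (rho x)%:E = 1.
  by rewrite -[RHS](probability_setT (unif m mA)) murho.
have ae_rho : {ae m, forall x, rho x = unif_density x}.
  have irho : m.-integrable [set: borel X] (EFin \o rho).
    apply/integrableP; split; first exact/measurable_EFinP.
    under eq_integral do rewrite /= ger0_norm//.
    by rewrite rhoT ltry.
  have := integral_ae_eq measurableT irho (g := EFin \o unif_density).
  move=> /(_ _ _)[||] //; first exact/measurable_EFinP.
    by move=> B _ mB; rewrite -murho// -muun.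
  move=> N' hN'; exists N'; case: hN' => mN' N'0 sub; split => // x.
  by move=> /= ne; apply: sub => /= /(_ I) [].
have -> : \int[m]_x (rho x * ln (rho x))%:E = (- ln M)%:E.
  transitivity (\int[m]_x ((\1_A x)%:E * (M^-1 * ln (M^-1))%:E)).
    apply: ae_eq_integral => //.
    - apply/measurable_EFinP; apply: (measurableT_comp (@measurable_mul_ln R)) => //.
    - by apply: emeasurable_funM => //; apply/measurable_EFinP.
    - apply: filterS ae_rho => x -> _; rewrite /unif_density indicE.
      by case: (x \in A); rewrite ?mul1r ?mul0r ?mul1e ?mul0e.
  rewrite integralZr//; last first.
    apply/integrableP; split; first exact/measurable_EFinP.
    under eq_integral do rewrite /= ger0_norm//.
    by rewrite integral_indic// setIT; have /andP[] := mA0.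
  rewrite integral_indic// setIT fin_measure -/M -EFinM mulrA mulfV ?gt_eqF//.
  by rewrite mul1r lnV.
rewrite fin_measure -/M poweR_EFin -EFinM -EFinN/= lee_fin.
by rewrite /powR gt_eqF// mulNr opprK mulrC.
Qed.

End uniform_measure.

(** * Distances along timelike plans *)

Section transport_between_compact_sets.
Local Open Scope ereal_scope.
Context (R : realType) (X : synthetic_spacetime R).

(** Since ell < +oo, the finite part of ell_+ is continuous and attains its
    maximum on the product of the two compact sets. *)
Lemma ell_bounded_compact (A B : set X) :
  continuous (fun p : (X * X)%type => ell_plus ell p.1 p.2) ->
  compact A -> compact B ->
  exists M : R, forall x y, A x -> B y -> ell_plus ell x y <= M%:E.
Proof.
move=> cl cA cB.
have finl x y : ell_plus ell x y \is a fin_num.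
  rewrite ge0_fin_numE ?le_max ?lexx ?orbT//.
  by rewrite /ell_plus gt_max ell_lty ltry.
have cf : continuous (fun p : (X * X)%type => fine (ell_plus ell p.1 p.2)).
  by move=> p; apply: fine_cvg; rewrite fineK ?finl//; exact: cl.
have [AB0|/set0P[p ABp]] := eqVneq (A `*` B) set0.
  by exists 0%R => x y Ax By; have : (A `*` B) (x, y) by []; rewrite AB0.
have ne : (A `*` B) !=set0 by exists p.
have [c _ cmax] := compact_EVT_max ne (compact_setX cA cB)
  (continuous_subspaceT cf).
exists (fine (ell_plus ell c.1 c.2)) => x y Ax By.
by rewrite -[leLHS]fineK ?finl// lee_fin; apply: (cmax (x, y)); rewrite inE.
Qed.

Lemma ell_plusE (x y : X) : 0 < ell x y ->
  ell_plus ell x y = (fine (ell x y))%:E /\ (0 < fine (ell x y))%R.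
Proof.
move=> l0; have lE : ell x y = (fine (ell x y))%:E.
  by rewrite fineK// gt0_fin_numE// ell_lty.
by rewrite /ell_plus max_l ?ltW// -lte_fin -lE.
Qed.

Variables (A B : set X) (K : R).

(** The bound on ell_+ matters when K < 0: the supremum is then finite, whereas
    [fine] would send an infinite one to 0. *)
Lemma Theta_curv_le (x y : X) :
  (exists M : R, forall x y, A x -> B y -> ell_plus ell x y <= M%:E) ->
  A x -> B y -> 0 < ell x y ->
  curv_le K (Theta K A B) (fine (ell x y)).
Proof.
move=> [M lM] Ax By l0; have [lE l1] := ell_plusE l0.
rewrite /curv_le /Theta; set E := [set _ | _ in _ & _ in _].
have El : E (fine (ell x y))%:E by exists x => //; exists y.
case: (leP 0%R K) => _.
  have E0 : 0 <= ereal_inf E.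
    by apply: le_ereal_inf_tmp => _ [a _ [b _ <-]]; rewrite le_max lexx orbT.
  have Efin : ereal_inf E \is a fin_num.
    by rewrite ge0_fin_numE// (le_lt_trans (ereal_inf_lbound El))// ltry.
  apply/andP; split; first exact: fine_ge0.
  by rewrite -lee_fin fineK//; exact: ereal_inf_lbound.
have EM : ereal_sup E <= M%:E.
  by apply: ge_ereal_sup => _ [a Aa [b Bb <-]]; exact: lM.
have Efin : ereal_sup E \is a fin_num.
  rewrite ge0_fin_numE ?(le_lt_trans EM) ?ltry//.
  by apply: le_trans (ereal_sup_ubound El); rewrite lee_fin ltW.
apply/andP; split; first exact: ltW.
by rewrite -lee_fin [leRHS]fineK//; exact: ereal_sup_ubound.
Qed.

End transport_between_compact_sets.

Section timelike_plans.
Local Open Scope ereal_scope.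
Context (R : realType) (X : synthetic_spacetime R).

(** The endpoint marginals of the plan are mu and nu, which are carried by A and
    B, and the coupling of the endpoints charges only chronological pairs. *)
Lemma timelike_plan_ae (q : R) (mu nu : probability (borel X) R)
    (A B : set (borel X)) (eta : probability (borel (Geo X)) R) :
  measurable A -> measurable B -> mu (~` A) = 0 -> nu (~` B) = 0 ->
  timelike_plan q mu nu eta ->
  {ae eta, forall c, [/\ A (ev I0 c), B (ev I1 c) & 0 < ell (ev I0 c) (ev I1 c)]}.
Proof.
move=> mA mB muA nuB [[cpl _] [N [mN N0 subN]]].
have mAC := measurableC mA; have mBC := measurableC mB.
have zA : eta (ev I0 @^-1` (~` A)) = 0.
  by rewrite -muA; exact: (cpl _ mAC).1.
have zB : eta (ev I1 @^-1` (~` B)) = 0.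
  by rewrite -nuB; exact: (cpl _ mBC).2.
have nA : eta.-negligible (ev I0 @^-1` (~` A)).
  by exists (ev I0 @^-1` (~` A)); split => //; exact: measurable_funPTI.
have nB : eta.-negligible (ev I1 @^-1` (~` B)).
  by exists (ev I1 @^-1` (~` B)); split => //; exact: measurable_funPTI.
have nN : eta.-negligible (@ev01 _ X @^-1` N).
  by exists (@ev01 _ X @^-1` N); split => //; exact: measurable_funPTI.
apply: negligibleS (negligibleU (negligibleU nA nB) nN) => c /= h.
have [Ac|?] := pselect (A (ev I0 c)); last by left; left.
have [Bc|?] := pselect (B (ev I1 c)); last by left; right.
by right; apply: subN => /= lc; apply: h.
Qed.

End timelike_plans.

Lemma I01_ge0_le1 (R : realType) (t : I01 R) : 0 <= \val t <= 1.
Proof. by have := valP t; rewrite inE /= in_itv. Qed.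

Lemma I01_onem_ge0_le1 (R : realType) (t : I01 R) : 0 <= 1 - \val t <= 1.
Proof. by have /andP[t0 t1] := I01_ge0_le1 t; rewrite subr_ge0 t1 gerBl. Qed.

Lemma ae_ex d (T : measurableType d) (R : realType) (mu : probability T R)
  (P : T -> Prop) : {ae mu, forall x, P x} -> exists x, P x.
Proof.
move=> [N [mN N0 subN]]; apply/not_existsP => nP.
have NT : N = [set: T] by apply/seteqP; split => // x _; apply: subN; exact: nP.
have : mu [set: T] = 0%E by rewrite -NT; exact: N0.
by rewrite probability_setT => /eqP; rewrite onee_eq0.
Qed.

Section mean_square_distance.
Local Open Scope ereal_scope.
Context (R : realType) (X : synthetic_spacetime R).
Variables (A B : set X) (K : R).

(** Theta is on the same side of all the distances, hence of their quadratic
    mean.  The bound on ell_+ makes this mean finite. *)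
Lemma Theta_curv_le_mean (eta : probability (borel (Geo X)) R) :
  (exists M : R, forall x y, A x -> B y -> ell_plus ell x y <= M%:E) ->
  {ae eta, forall c, [/\ A (ev I0 c), B (ev I1 c) & 0 < ell (ev I0 c) (ev I1 c)]} ->
  curv_le K (Theta K A B)
    (fine ((\int[eta]_c ell (ev I0 c) (ev I1 c) ^+ 2) `^ 2^-1)).
Proof.
move=> bAB aeAB; have [M lM] := bAB.
set f := fun c : borel (Geo X) => ell (ev I0 c) (ev I1 c).
have f0 c : 0 <= f c ^+ 2.
  by rewrite /f expe2; case: (ell _ _) => [r| |] //=; rewrite ?lee_fin -?expr2 ?sqr_ge0 ?mulyy ?mulNyNy ?leey.
have aeC : {ae eta, forall c, f c = (fine (f c))%:E /\
    [/\ (0 <= fine (f c))%R, (fine (f c) <= M)%R & curv_le K (Theta K A B) (fine (f c))]}.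
  apply: filterS aeAB => c [Ac Bc l0]; have [lE l1] := ell_plusE l0.
  split; first by rewrite /f fineK// gt0_fin_numE// ell_lty.
  split; [exact: ltW| |exact: (Theta_curv_le K bAB Ac Bc l0)].
  by rewrite -lee_fin -lE; exact: lM.
set I := integral _ _ _.
have I_ge0 : 0 <= I by apply: integral_ge0 => c _; exact: f0.
have IM : I <= (M ^+ 2)%:E.
  apply: ae_le_cst_integral => //; first by rewrite lee_fin sqr_ge0.
  apply: filterS aeC => c [fE [fc0 fM _]].
  by rewrite -/(f c) fE -EFin_expe lee_fin ler_sqr// ?nnegrE// (le_trans fc0).
have [J IJ] : exists J, I = J%:E.
  by exists (fine I); rewrite fineK// ge0_fin_numE// (le_lt_trans IM)// ltry.
have J0 : (0 <= J)%R by rewrite -lee_fin -IJ.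
rewrite IJ poweR12_sqrt ?lee_fin//=.
have [c [_ [c0 _ cT]]] := ae_ex aeC; have [T0 _] := curv_le_ge0 cT.
rewrite /curv_le sqrtr_ge0 T0 /=.
have aeT c' (T := Theta K A B) : f c' = (fine (f c'))%:E /\
    [/\ (0 <= fine (f c'))%R, (fine (f c') <= M)%R & curv_le K T (fine (f c'))] ->
    if (0 <= K)%R then (T ^+ 2)%:E <= f c' ^+ 2 else f c' ^+ 2 <= (T ^+ 2)%:E.
  move=> [fE [fc0 _]]; rewrite fE -EFin_expe !lee_fin !ler_sqr ?nnegrE//.
  by rewrite /curv_le; case: ifP => _ /andP[].
case: ifP aeT => K0 aeT.
  rewrite -(ger0_norm T0) -sqrtr_sqr ler_sqrt// -lee_fin -IJ.
  apply: ae_ge_cst_integral => //; first by rewrite lee_fin sqr_ge0.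
  by apply: filterS aeC => c' /aeT.
rewrite -[leRHS](ger0_norm T0) -sqrtr_sqr ler_sqrt ?sqr_ge0// -lee_fin -IJ.
apply: ae_le_cst_integral => //; first by rewrite lee_fin sqr_ge0.
by apply: filterS aeC => c' /aeT.
Qed.


End mean_square_distance.

Theorem theorem3p1 (R : realType) (X : synthetic_spacetime R)
    (m : {measure set (borel X) -> \bar R}) (N K q : R)
    (hN : 1 < N) (hq : 0 < q < 1)
    (hm : measured m) (hgh : globally_hyperbolic X)
    (hcont : continuous (fun p : (X * X)%type => ell_plus ell p.1 p.2)) :
  (TCD m q K N -> forall N' : R, N < N' -> sTBM m q K N') /\
  (TCDe m q K N -> sTBM_star m q K N).
Proof.
split=> [tcd N' NN' A B mA mB cA cB A0 B0 tp|tcde A B mA mB cA cB A0 B0 tp].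
  have N'1 : 1 < N' by exact: lt_trans NN'.
  have [eta pl S_le] := tcd _ _ _ _ (unif_Pc_ac mA A0 cA) (unif_Pc_ac mB B0 cB)
    (unif_has_density mA A0) (unif_has_density mB B0) tp.
  exists eta => // t; rewrite -leeN2.
  apply: le_trans (spt_S_ge (tau_polish X) m _ N'1) _.
  apply: le_trans (S_le _ t NN') _; rewrite leeN2.
  apply: ae_ge_cst_integral => [c||].
  - by rewrite adde_ge0// mule_ge0// ?tau_ge0// lee_fin powR_ge0.
  - by rewrite adde_ge0// mule_ge0// ?tau_ge0// poweR_ge0.
  have aeAB := timelike_plan_ae mA mB (unif_setC mA A0) (unif_setC mB B0) pl.
  have bAB := ell_bounded_compact hcont cA cB.
  apply: filterS aeAB => c [Ac Bc l0] /=.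
  have Tl := Theta_curv_le K bAB Ac Bc l0.
  have pw (D : set (borel X)) (mD : measurable D) (D0 : (0 < m D < +oo)%E) x :
    D x -> ((unif_density m D x `^ (- N'^-1))%:E = m D `^ N'^-1)%E.
    move=> Dx; have M0 := fine_measure_gt0 D0.
    rewrite (fin_measure D0) /unif_density indicE mem_set// mul1r.
    by rewrite -(powR_inv1 (ltW M0)) -powRrM mulrNN mul1r.
  rewrite !pw//; apply: leeD; apply: lee_wpmul2r; rewrite ?poweR_ge0//.
  - exact: tau_curv_le (I01_onem_ge0_le1 t) Tl.
  - exact: tau_curv_le (I01_ge0_le1 t) Tl.
have aeAB := timelike_plan_ae mA mB (unif_setC mA A0) (unif_setC mB B0).
have [eta pl U_le] := tcde _ _ (unif_Pc_ac mA A0 cA) (unif_Pc_ac mB B0 cB) tp.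
exists eta => // t.
have N0 : 0 < N by exact: lt_trans hN.
have bAB := ell_bounded_compact hcont cA cB.
have TL := Theta_curv_le_mean K bAB (aeAB _ _ pl).
rewrite -(curv_le_div _ _ _ N0) in TL.
have [T0 L0] := curv_le_ge0 TL.
apply: le_trans (U_le_spt (tau_polish X) m _ N0).
apply: le_trans (U_le t).
by apply: leeD; apply: lee_pmul; rewrite ?poweR_ge0 ?sigma_ge0 ?U_unif_ge
  ?sigma_curv_le ?I01_ge0_le1 ?I01_onem_ge0_le1.
Qed.
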